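(* Let $0<\varepsilon<1$ and consider edge-weighted graphs with positive weights normalized so that the maximum edge weight is $1$, and assume $w_{\min}(\varepsilon)<1$. There exists a $\mathrm{CentLocal}[\varphi]$-algorithm for $(1-\varepsilon)$-approximate maximum weighted matching (on a query edge it answers membership in a fixed matching $M$ with $w(M)\ge(1-\varepsilon)w(M^*_w)$, $M^*_w$ a maximum weight matching) with $$\varphi=\left(\frac{1}{w_{\min}(\varepsilon)}\right)^{\Delta^{O(1/\varepsilon)}}\cdot (\log^* n)^{O(\frac{1}{\varepsilon}\log\frac{1}{\varepsilon})}.$$
   Context: Graphs are undirected and labeled: $n$ vertices with distinct IDs in $\{1,\dots,n\}$, each vertex has ports pointing to its neighbors in a fixed arbitrary way; $\Delta$ is the maximum degree; each edge $e$ has a weight $w(e)$, and $w(F)=\sum_{e\in F}w(e)$. The algorithm knows $n$, $\Delta$, $\varepsilon$, and the maximum edge weight. Define $w_{\min}(\varepsilon)=\min\{w(e): w(e)\ge \varepsilon/n\}$ (after normalization so the maximum weight is $1$). In the CentLocal model an algorithm accesses the graph only via probes $(v,i)$ returning the $i$-th neighbor of $v$ (with the edge weight and port number at the neighbor), answers an online sequence of queries, and must be consistent with one fixed solution for all query sequences; $\mathrm{CentLocal}[q]$ means at most $q$ probes per query.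
   Formalization: The constant in Δ^{O(1/ε)} is uniform over graphs with w_min(ε) ≤ ω for each fixed ω < 1 (one constant for all w_min(ε) < 1 is impossible), and the second exponent is read as O((1/ε)(1+log(1/ε))), which differs only for ε near 1. *)

(* Defs.v *)
From HB Require Import structures.
From mathcomp Require Import all_boot all_order all_algebra.
From mathcomp Require Import reals exp.

Set Implicit Arguments.
Unset Strict Implicit.
Unset Printing Implicit Defensive.

Import Order.TTheory GRing.Theory Num.Theory.
Local Open Scope ring_scope.

(* Vertices are identified with their IDs; the IDs 1, ..., n and the port
   numbers 1, ..., deg v are shifted to start at 0.  An edge is the set of its
   two endpoints, and only the values of [wt] on edges are meaningful. *)
Record wgraph (R : realType) (n : nat) := WGraph {
  adj : rel 'I_n;
  ports : 'I_n -> seq 'I_n;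
  wt : {set 'I_n} -> R;
  adj_sym : symmetric adj;
  adj_irrefl : irreflexive adj;
  ports_uniq : forall v, uniq (ports v);
  ports_adj : forall u v, (v \in ports u) = adj u v
}.

Section Graphs.
Variables (R : realType) (n : nat) (G : wgraph R n).

Definition edges : {set {set 'I_n}} :=
  [set [set u; v] | u in 'I_n, v in 'I_n & adj G u v].

Definition maxdeg : nat := (\max_(v < n) #|adj G v|)%N.

Definition weight (F : {set {set 'I_n}}) : R := \sum_(e in F) wt G e.

Definition positive_weights : Prop := forall e, e \in edges -> 0 < wt G e.

Definition max_weight : R := \big[Num.max/0]_(e in edges) wt G e.

(* When eps / n <= max_weight and there is an edge, a heaviest edge satisfies
   the condition, so the initial value does not affect the minimum. *)
Definition w_min (eps : R) : R :=
  \big[Num.min/max_weight]_(e in edges | eps / n%:R <= wt G e) wt G e.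

Definition matching (M : {set {set 'I_n}}) : bool :=
  (M \subset edges) && trivIset M.

Definition max_weight_matching (M : {set {set 'I_n}}) : Prop :=
  matching M /\ forall M', matching M' -> weight M' <= weight M.

Lemma max_weight_matching_exists : exists M, max_weight_matching M.
Proof.
have m0 : matching set0.
  by rewrite /matching sub0set; apply/trivIsetP => A B; rewrite inE.
case: (arg_maxP weight m0) => M mM maxM.
by exists M; split=> // M' /maxM.
Qed.

Definition approx_mwm (eps : R) (M : {set {set 'I_n}}) : Prop :=
  matching M /\
  forall Mstar, max_weight_matching Mstar ->
    (1 - eps) * weight Mstar <= weight M.

End Graphs.

(* The reply to a probe (v, i): the i-th neighbor u of v, the weight of the
   edge {u, v}, and the port number of v at u; None if v has no i-th port. *)
Definition reply (R : realType) (n : nat) : Type := option ('I_n * R * nat).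

Definition probe (R : realType) (n : nat) (G : wgraph R n)
    (v : 'I_n) (i : nat) : reply R n :=
  if (i < size (ports G v))%N then
    let u := nth v (ports G v) i in
    Some (u, wt G [set v; u], index v (ports G u))
  else None.

Inductive probe_tree (R : realType) (n : nat) (T : Type) : Type :=
  | Output of T
  | Probe of 'I_n & nat & (reply R n -> probe_tree R n T).

Fixpoint run (R : realType) (n : nat) (T : Type) (G : wgraph R n)
    (t : probe_tree R n T) : T * nat :=
  match t with
  | Output x => (x, 0%N)
  | Probe v i k => let: (x, c) := run G (k (probe G v i)) in (x, c.+1)
  end.

(* A deterministic online algorithm for edge queries with yes/no answers; the
   state carries whatever it remembers from one query to the next. *)
Record algorithm (R : realType) (n : nat) := Algorithm {
  state : Type;
  init : state;
  step : state -> {set 'I_n} -> probe_tree R n (bool * state)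
}.

(* The answers to a sequence of queries, each with its number of probes. *)
Fixpoint online (R : realType) (n : nat) (G : wgraph R n)
    (A : algorithm R n) (s : state A) (qs : seq {set 'I_n}) :
    seq (bool * nat) :=
  match qs with
  | [::] => [::]
  | q :: qs' =>
      let: ((b, s'), c) := run G (step s q) in (b, c) :: online G s' qs'
  end.

(* On G, A is a CentLocal[phi] algorithm for (1 - eps)-approximate maximum
   weighted matching: M is chosen before the query sequence. *)
Definition centlocal_mwm (R : realType) (n : nat) (phi eps : R)
    (A : algorithm R n) (G : wgraph R n) : Prop :=
  exists2 M : {set {set 'I_n}}, approx_mwm G eps M &
    forall qs : seq {set 'I_n}, all (fun e => e \in edges G) qs ->
      [seq r.1 | r <- online G (init A) qs] = [seq e \in M | e <- qs] /\
      all (fun r => r.2%:R <= phi) (online G (init A) qs).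

Section LogStar.
Variable R : realType.

Definition log2 (x : R) : R := ln x / ln 2.

Lemma iter_log2_le1 (n : nat) : exists k, iter k log2 n%:R <= 1.
Proof.
suff H m (x : R) : x <= m.+1%:R -> exists k, iter k log2 x <= 1.
  by apply: (H n); rewrite ler_nat.
elim: m x => [|m IH] x xm; first by exists 0%N.
have [x1|x1] := leP x 1; first by exists 0%N.
have [k Hk] : exists k, iter k log2 (log2 x) <= 1.
  apply: IH; rewrite /log2 ler_pdivrMr ?ln_gt0 ?ltr1n //.
  rewrite mulrC mulr_natr -lnXn ?ltr0n // ler_ln ?posrE ?exprn_gt0 ?ltr0n //.
    by apply: le_trans xm _; rewrite -natrX ler_nat ltn_expl.
  exact: lt_trans x1.
by exists k.+1; rewrite iterSr.
Qed.

Definition log_star (n : nat) : nat := ex_minn (iter_log2_le1 n).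

End LogStar.

(* (1 / w) ^ (Delta ^ O(1/eps)) * (log^* n) ^ O((1/eps) log(1/eps)), with c1
   and c2 the constants of the two O's.  The summand 1 only matters for eps
   close to 1, where (1/eps) log(1/eps) tends to 0 and O((1/eps) log(1/eps))
   has to be read as O(1); it is absorbed by c2 for eps <= 1/2.  As w tends
   to 1 with the other arguments fixed, the first factor tends to 1 and the
   dependence on Delta is lost, so c1 can only be uniform over w <= omega, for
   each omega < 1. *)
Definition probe_bound (R : realType) (c1 c2 w eps : R) (Delta n : nat) : R :=
  (w^-1 `^ (Delta%:R `^ (c1 * eps^-1))) *
  ((log_star R n)%:R `^ (c2 * (eps^-1 * (1 + ln eps^-1)))).

(* Main.v *)
Require Import Defs.
From HB Require Import structures.
From mathcomp Require Import all_boot all_order all_algebra all_field.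
From mathcomp Require Import boolp reals exp lra zify.

Set Implicit Arguments.
Unset Strict Implicit.
Unset Printing Implicit Defensive.

Import Order.TTheory GRing.Theory Num.Theory.
Local Open Scope ring_scope.

(* Let k be about 1/eps, L = 4k, and improve a matching M, starting from the
   empty one, in rounds.  In a round every vertex v computes the best
   replacement of M inside the ball of radius L around v; its gain is g(v).
   For an optimal matching O, walks of length L that alternate between M and
   O show (L - 2) w(O) - L w(M) <= L * sum_v g(v).  The balls of radius 2L
   have at most D = (Delta + 1)^(2L) elements, so a local-ratio argument selects
   centers with disjoint balls carrying a fraction 1/D of the total gain, and
   2kD rounds suffice, whatever the weights are.

   The local-ratio selection processes the classes of a proper coloring of the
   power graph G^(2L) one after the other.  Following a fixed sequence of 2L
   ports is a map from the vertices to themselves, on which Cole-Vishkin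
   reduces the IDs to 16 colors by looking at log* n + 1 iterates only; the
   vector of these D colors is reduced to O(D^4) colors by evaluating
   polynomials over a finite field (Linial).  Hence log* n enters the number of
   probes linearly, and the remaining factor is at most
   2 ^ Delta ^ O(1/eps) <= (1/w) ^ Delta ^ O(1/eps) for w <= omega. *)

(** * Balls, walks and probe programs *)

Section Balls.
Variables (R : realType) (n : nat) (G : wgraph R n).
Implicit Types (u v w : 'I_n).

Definition near v w := (v == w) || adj G v w.

Lemma near_sym : symmetric near.
Proof. by move=> v w; rewrite /near eq_sym adj_sym. Qed.

Fixpoint ball k v : {set 'I_n} :=
  if k is k'.+1 then \bigcup_(w | near v w) ball k' w else [set v].

Lemma ballSP k u v :
  reflect (exists2 w, near v w & u \in ball k w) (u \in ball k.+1 v).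
Proof. exact: bigcupP. Qed.

Lemma ballDP a b u v :
  reflect (exists2 w, w \in ball a v & u \in ball b w) (u \in ball (a + b) v).
Proof.
elim: a v => [|a IH] v.
  apply: (iffP idP) => [ub|[w]]; first by exists v => //; rewrite inE.
  by rewrite inE => /eqP->.
apply: (iffP (ballSP _ _ _)) => [[w vw /IH[x xw ux]]|[x /ballSP[w vw xw] ux]].
  by exists x => //; apply/ballSP; exists w.
by exists w => //; apply/IH; exists x.
Qed.

Lemma ball_refl k v : v \in ball k v.
Proof.
elim: k => [|k IH]; first by rewrite inE.
by apply/ballSP; exists v => //; rewrite /near eqxx.
Qed.

Lemma ball1 u v : (u \in ball 1 v) = near v u.
Proof.
apply/ballSP/idP => [[w vw]|vu]; first by rewrite inE => /eqP->.
by exists u => //; rewrite inE.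
Qed.

Lemma ball_sym k u v : (u \in ball k v) = (v \in ball k u).
Proof.
suff H x y : x \in ball k y -> y \in ball k x by apply/idP/idP; apply: H.
elim: k x y => [|k IH] x y; first by rewrite !inE eq_sym.
case/ballSP => w yw /IH wx; rewrite -addn1; apply/ballDP; exists w => //.
by rewrite ball1 near_sym.
Qed.

Lemma ball_trans a b u v w :
  w \in ball a v -> u \in ball b w -> u \in ball (a + b) v.
Proof. by move=> wv uw; apply/ballDP; exists w. Qed.

Lemma subset_ball a b v : (a <= b)%N -> ball a v \subset ball b v.
Proof.
move=> ab; apply/subsetP => u uv; rewrite -(subnKC ab).
exact: ball_trans uv (ball_refl _ _).
Qed.

(** A missing port leads back to [v], so following a fixed sequence of ports is a total map of the
    vertices, as Cole-Vishkin requires. *)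
Definition hop v i := nth v (ports G v) i.

Lemma near_hop v i : near v (hop v i).
Proof.
rewrite /near /hop; have [lt_i|le_i] := ltnP i (size (ports G v)).
  by rewrite -ports_adj mem_nth ?orbT.
by rewrite nth_default ?eqxx.
Qed.

Lemma size_ports v : (size (ports G v) <= maxdeg G)%N.
Proof.
have -> : size (ports G v) = #|adj G v|.
  by rewrite -(card_uniqP (ports_uniq G v)); apply: eq_card => u; rewrite ports_adj.
exact: (@leq_bigmax _ (fun v : 'I_n => #|adj G v|)).
Qed.

Lemma hop_near d v w : (maxdeg G <= d)%N -> near v w ->
  exists i : 'I_d.+1, hop v i = w.
Proof.
move=> degd; case/orP => [/eqP<-|vw].
  (* No vertex has a port [d], so this port encodes staying in place. *)
  exists ord_max; rewrite /hop nth_default //=.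
  exact: leq_trans (size_ports v) degd.
rewrite -ports_adj in vw.
have lt_i : (index w (ports G v) < d.+1)%N.
  by rewrite ltnS (leq_trans _ degd) // (leq_trans _ (size_ports v)) // index_size.
by exists (Ordinal lt_i); rewrite /hop nth_index.
Qed.

Definition walk d v (s : seq 'I_d) := foldl (fun w (i : 'I_d) => hop w i) v s.

Lemma walk_ball d v (s : seq 'I_d) : walk v s \in ball (size s) v.
Proof.
elim: s v => [|i s IH] v /=; first by rewrite inE.
by apply/ballSP; exists (hop v i); rewrite ?near_hop.
Qed.

Lemma ball_walk d k u v : (maxdeg G <= d)%N -> u \in ball k v ->
  exists s : k.-tuple 'I_d.+1, walk v s = u.
Proof.
move=> degd; elim: k v => [|k IH] v.
  by rewrite inE => /eqP->; exists [tuple].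
case/ballSP => w /(hop_near degd)[i <-] /IH[s sE].
by exists [tuple of i :: s].
Qed.

Lemma card_ball d k v : (maxdeg G <= d)%N -> (#|ball k v| <= d.+1 ^ k)%N.
Proof.
move=> degd; rewrite -[X in (_ <= X ^ _)%N]card_ord -card_tuple.
apply: leq_trans (leq_imset_card (fun s : k.-tuple 'I_d.+1 => walk v s) predT).
apply/subset_leq_card/subsetP => u /(ball_walk degd)[s <-].
by apply/imsetP; exists s.
Qed.

End Balls.

(** * Composing probe programs and counting their probes *)

Section Programs.
Variables (R : realType) (n : nat).
Local Notation tree := (probe_tree R n).

Fixpoint bind S T (t : tree S) (f : S -> tree T) : tree T :=
  match t with
  | Output x => f x
  | Probe v i k => Probe v i (fun a => bind (k a) f)
  end.

Lemma run_bind S T G (t : tree S) (f : S -> tree T) :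
  run G (bind t f) =
  ((run G (f (run G t).1)).1, ((run G t).2 + (run G (f (run G t).1)).2)%N).
Proof.
elim: t => [x|v i k IH] /=; first by case: (run G (f x)).
by rewrite IH; case: (run G (k _)).
Qed.

Fixpoint collect S T (f : S -> tree T) (s : seq S) : tree (seq T) :=
  if s is x :: s' then
    bind (f x) (fun y => bind (collect f s') (fun ys => Output R n (y :: ys)))
  else Output R n [::].

Lemma run_collect S T G (f : S -> tree T) (s : seq S) c :
  (forall x, ((run G (f x)).2 <= c)%N) ->
  (run G (collect f s)).1 = [seq (run G (f x)).1 | x <- s] /\
  ((run G (collect f s)).2 <= size s * c)%N.
Proof.
move=> fc; elim: s => [|x s [IH1 IH2]] //=.
rewrite !run_bind /= IH1 addn0; split=> //.
by rewrite mulSn leq_add.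
Qed.

Fixpoint walk_prog d v (s : seq 'I_d) : tree 'I_n :=
  if s is i :: s' then
    Probe v i (fun a => walk_prog (if a is Some (u, _, _) then u else v) s')
  else Output R n v.

Lemma run_walk_prog G d v (s : seq 'I_d) :
  run G (walk_prog v s) = (walk G v s, size s).
Proof.
elim: s v => [|i s IH] v //=; rewrite IH; congr (walk _ _ _, _).
rewrite /probe /hop; case: ltnP => // le_i.
by rewrite nth_default.
Qed.

End Programs.

(** * Maps computable at each vertex with a bounded number of probes *)

Section Locality.
Variables (R : realType) (n d : nat).
Local Notation V := 'I_n.

(** One program has to serve all graphs of maximum degree at most [d], so it learns about [G] from
    replies only. *)
Definition local S (f : wgraph R n -> V -> S) (c : nat) :=
  exists P : V -> probe_tree R n S, forall G v, (maxdeg G <= d)%N ->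
    (run G (P v)).1 = f G v /\ ((run G (P v)).2 <= c)%N.

Lemma local_le S (f : wgraph R n -> V -> S) c c' :
  (c <= c')%N -> local f c -> local f c'.
Proof.
move=> cc [P HP]; exists P => G v /(HP G v)[-> H2].
by split=> //; apply: leq_trans cc.
Qed.

Lemma local_const S (x : V -> S) : local (fun _ v => x v) 0.
Proof. by exists (fun v => Output R n (x v)). Qed.

Lemma local_map S T (h : V -> S -> T) (f : wgraph R n -> V -> S) c :
  local f c -> local (fun G v => h v (f G v)) c.
Proof.
case=> P HP; exists (fun v => bind (P v) (fun x => Output R n (h v x))) => G v Gd.
have [H1 H2] := HP G v Gd.
by rewrite run_bind /= H1 addn0.
Qed.

Lemma local_ext S (f g : wgraph R n -> V -> S) c :
  (forall G v, (maxdeg G <= d)%N -> f G v = g G v) -> local f c -> local g c.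
Proof.
by move=> fg [P HP]; exists P => G v Gd; rewrite -fg //; apply: HP.
Qed.

Lemma local_pair S T (f : wgraph R n -> V -> S) (g : wgraph R n -> V -> T) c c' :
  local f c -> local g c' -> local (fun G v => (f G v, g G v)) (c + c').
Proof.
case=> P HP [Q HQ].
exists (fun v => bind (P v) (fun x => bind (Q v) (fun y => Output R n (x, y)))).
move=> G v Gd; have [H1 H2] := HP G v Gd; have [H3 H4] := HQ G v Gd.
by rewrite !run_bind /= H1 H3 addn0; split=> //; apply: leq_add.
Qed.

(** Only probes are counted: after computing [f G v], the program may pick, by choice, any graph of
    degree at most [d] with this value of [f] at [v] and return its [g]. To bound the probes of a
    map it thus suffices to show which data determine it. *)
Lemma local_det S T (f : wgraph R n -> V -> S) (g : wgraph R n -> V -> T) c (y0 : T) :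
  local f c ->
  (forall G G' v, (maxdeg G <= d)%N -> (maxdeg G' <= d)%N ->
     f G v = f G' v -> g G v = g G' v) ->
  local g c.
Proof.
move=> Lf det.
pose F v x : T :=
  if pselect (exists G, (maxdeg G <= d)%N /\ f G v = x) is left ex
  then g (projT1 (cid ex)) v else y0.
apply: local_ext (local_map F Lf) => G v Gd; rewrite /F.
case: pselect => [ex|[]]; last by exists G.
by case: (cid ex) => G' [/= G'd E]; apply: det.
Qed.

Lemma local_collect (I : Type) T (f : I -> wgraph R n -> V -> T) (s : seq I) c :
  (forall i, local (f i) c) ->
  local (fun G v => [seq f i G v | i <- s]) (size s * c).
Proof.
move=> /choice[P HP]; exists (fun v => collect (fun i => P i v) s) => G v Gd.
have [-> H2] := run_collect s (fun i => (HP i G v Gd).2).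
by split=> //; apply: eq_map => i; apply: (HP i G v Gd).1.
Qed.

Lemma local_walk k (s : k.-tuple 'I_d.+1) : local (fun G v => walk G v s) k.
Proof.
by exists (fun v => walk_prog R v s) => G v _; rewrite run_walk_prog size_tuple.
Qed.

Lemma local_comp S (p : wgraph R n -> V -> V) (f : wgraph R n -> V -> S) c c' :
  local p c -> local f c' -> local (fun G v => (p G v, f G (p G v))) (c + c').
Proof.
case=> P HP [Q HQ].
exists (fun v => bind (P v) (fun u => bind (Q u) (fun y => Output R n (u, y)))).
move=> G v Gd; have [H1 H2] := HP G v Gd; have [H3 H4] := HQ G (p G v) Gd.
by rewrite !run_bind /= H1 H3 addn0; split=> //; apply: leq_add.
Qed.

Lemma local_traject (p : wgraph R n -> V -> V) c k :
  local p c -> local (fun G v => traject (p G) v k) (k * c).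
Proof.
move=> Lp; elim: k => [|k IH]; first exact: local_const.
rewrite mulSn; apply: local_ext (local_map (fun v x => v :: x.2) (local_comp Lp IH)).
by [].
Qed.

Lemma local_walks S T (f : wgraph R n -> V -> S) (g : wgraph R n -> V -> T)
    k c (y0 : T) :
  local f c ->
  (forall G G' v, (maxdeg G <= d)%N -> (maxdeg G' <= d)%N ->
     (forall s : k.-tuple 'I_d.+1, walk G v s = walk G' v s /\
        f G (walk G v s) = f G' (walk G' v s)) -> g G v = g G' v) ->
  local g (d.+1 ^ k * (k + c)).
Proof.
move=> Lf det; rewrite -[X in (X ^ _ * _)%N]card_ord -card_tuple cardE.
apply: (local_det y0 (local_collect (enum {: k.-tuple 'I_d.+1})
                        (fun s => local_comp (local_walk s) Lf))).
move=> G G' v Gd G'd E; apply: det => // s.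
have /eq_in_map/(_ s) := E.
by rewrite mem_enum => /(_ isT)[-> ->].
Qed.

Lemma local_probes k : local (fun G v => [seq probe G v i | i <- iota 0 k]) k.
Proof.
rewrite -[X in local _ X]muln1 -[X in local _ (X * _)](size_iota 0 k).
apply: local_collect => i.
by exists (fun v => Probe v i (fun a => Output R n a)).
Qed.

(** Walks of [k] ports from [v] end exactly in the points of the ball. Adjacency and weights are not
    part of these data: where [g] needs them, [f] has to supply them. *)
Lemma local_ball S T (f : wgraph R n -> V -> S) (g : wgraph R n -> V -> T)
    k c (y0 : T) :
  local f c ->
  (forall G G' v, ball G k v = ball G' k v ->
     (forall u, u \in ball G k v -> f G u = f G' u) -> g G v = g G' v) ->
  local g (d.+1 ^ k * (k + c)).
Proof.
move=> Lf det; apply: (local_walks y0 Lf) => G G' v Gd G'd same.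
apply: det => [|u /(ball_walk Gd)[s <-]]; last first.
  by have [E ->] := same s; rewrite E.
apply/setP => u; apply/idP/idP => [/(ball_walk Gd)|/(ball_walk G'd)] [s <-].
  by have [-> _] := same s; rewrite -[X in ball _ X](size_tuple s) walk_ball.
by have [<- _] := same s; rewrite -[X in ball _ X](size_tuple s) walk_ball.
Qed.

End Locality.

(** * Local-ratio selection *)

Section LocalRatio.
Variables (R : realType) (V C : finType) (H : V -> {set V}) (col : V -> C).

(* A vertex of the first color subtracts its value from
   all its neighbors and, once the later colors have been treated, enters the
   set if no neighbor has done so. *)
Definition residual (c : C) (g : V -> R) (u : V) : R :=
  if col u == c then 0
  else Num.max 0 (g u - \sum_(v | (v \in H u) && (col v == c)) g v).

Definition extend (c : C) (g : V -> R) (I : V -> bool) (v : V) : bool :=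
  I v || [&& col v == c, 0 < g v & [forall u, (u \in H v) ==> ~~ I u]].

Fixpoint select (cs : seq C) (g : V -> R) : V -> bool :=
  if cs is c :: cs' then extend c g (select cs' (residual c g))
  else fun=> false.

Hypothesis H_refl : forall v, v \in H v.
Hypothesis H_sym : forall u v, (u \in H v) = (v \in H u).
Hypothesis H_proper : forall u v, u \in H v -> col u = col v -> u = v.

Lemma residual_ge0 c g u : 0 <= residual c g u.
Proof. by rewrite /residual; case: ifP => // _; rewrite le_max lexx. Qed.

Lemma residual_gt0 c g u : 0 < residual c g u ->
  col u != c /\
  g u = residual c g u + \sum_(v | (v \in H u) && (col v == c)) g v.
Proof.
rewrite /residual; case: ifP => [_|_]; first by rewrite ltxx.
by rewrite lt_max ltxx /= => r_gt0; rewrite max_r ?subrK // ltW.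
Qed.

Lemma residual_pos c g u : (forall v, 0 <= g v) -> 0 < residual c g u -> 0 < g u.
Proof.
by move=> g0 r_gt0; have [_ ->] := residual_gt0 r_gt0; rewrite ltr_wpDr ?sumr_ge0.
Qed.

Lemma select_pos cs g v : (forall u, 0 <= g u) -> select cs g v -> 0 < g v.
Proof.
elim: cs g v => [|c cs IH] g v g0 //= /orP[/IH|/and3P[]//].
by move=> /(_ (residual_ge0 c g)); apply: residual_pos.
Qed.

Lemma select_indep cs g u v : (forall w, 0 <= g w) ->
  select cs g u -> select cs g v -> u \in H v -> u = v.
Proof.
elim: cs g u v => [|c cs IH] g u v g0 //=.
have r0 := residual_ge0 c g.
case/orP => [Iu|/and3P[/eqP cu _ /forallP/= nu]].
  case/orP => [Iv|/and3P[_ _ /forallP/= nv]] uv; first exact: IH Iu Iv uv.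
  by have := nv u; rewrite uv Iu.
case/orP => [Iv|/and3P[/eqP cv _ _]] uv.
  by have := nu v; rewrite H_sym uv Iv.
by apply: H_proper => //; rewrite cu cv.
Qed.

(** Local-ratio accounting for the first color. On the left, subtracting the values of this class
    lowers the total by at most [#|H v| <= D] times each [g v]. On the right, each [g v] of the
    class is recovered at least once: either [v] enters the set, or a neighbor in the set exceeds
    its residual by at least [g v]. *)
Lemma select_total D cs g : (forall v, #|H v| <= D)%N ->
  (forall v, 0 <= g v) -> (forall v, 0 < g v -> col v \in cs) ->
  \sum_v g v <= D%:R * \sum_(v | select cs g v) g v.
Proof.
move=> HD; elim: cs g => [|c cs IH] g g0 gcs /=.
  rewrite big_pred0_eq mulr0 big1 // => v _.
  by apply/eqP; rewrite eq_le g0 andbT leNgt; apply/negP => /gcs.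
set g' := residual c g; set I := select cs g'.
have r0 : forall v, 0 <= g' v := residual_ge0 c g.
have step u : g u <= g' u + \sum_(v | (v \in H u) && (col v == c)) g v.
  rewrite /g' /residual; case: ifP => [cu|_].
    by rewrite add0r (bigD1 u) /= ?H_refl ?cu // lerDl sumr_ge0.
  by rewrite -lerBlDr le_max lexx orbT.
have {}IH : \sum_v g' v <= D%:R * \sum_(v | I v) g' v.
  apply: IH => // v gv; have [cv _] := residual_gt0 gv.
  by have := gcs _ (residual_pos g0 gv); rewrite inE (negPf cv).
apply: le_trans (ler_sum _ (fun u _ => step u)) _.
have -> : \sum_(v | extend c g I v) g v = \sum_(v | I v) g v +
    \sum_(v | [&& col v == c, 0 < g v & [forall u, (u \in H v) ==> ~~ I u]]) g v.
  rewrite /extend (bigID I) /=; congr (_ + _); apply: eq_bigl => v.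
    by case: (I v); rewrite ?andbT ?andbF.
  have [Iv|] := boolP (I v); rewrite /= ?andbT //.
  by have [/negPf->] := residual_gt0 (select_pos r0 Iv).
rewrite big_split /=.
have -> : \sum_(v | I v) g v =
    \sum_(v | I v) g' v + \sum_(v | col v == c) g v *+ #|[set u in H v | I u]|.
  have -> : \sum_(v | I v) g v = \sum_(u | I u)
      (g' u + \sum_(v | (v \in H u) && (col v == c)) g v).
    by apply: eq_bigr => u Iu; have [_ ->] := residual_gt0 (select_pos r0 Iu).
  rewrite big_split /=; congr (_ + _).
  rewrite (exchange_big_dep (fun v => col v == c)) /=; last by move=> u v _ /andP[].
  apply: eq_bigr => v cv; rewrite -sumr_const; apply: eq_bigl => u.
  by rewrite inE cv andbT andbC H_sym.
have -> : \sum_u \sum_(v | (v \in H u) && (col v == c)) g v =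
    \sum_(v | col v == c) g v *+ #|H v|.
  rewrite (exchange_big_dep (fun v => col v == c)) /=; last by move=> u v _ /andP[].
  apply: eq_bigr => v cv; rewrite -sumr_const; apply: eq_bigl => u.
  by rewrite cv andbT H_sym.
rewrite -addrA mulrDr lerD // (le_trans (y := D%:R * \sum_(v | col v == c) g v)) //.
  rewrite mulr_sumr ler_sum // => v _.
  by rewrite -[leLHS]mulr_natl ler_wpM2r // ler_nat.
apply: ler_wpM2l => //.
(* The vertices of color [c] that enter pay for themselves; each other one has value 0 or a neighbor
   in [I], hence multiplicity at least 1. *)
rewrite (bigID (fun v => (0 < g v) && [forall u, (u \in H v) ==> ~~ I u])) /= addrC.
rewrite lerD //.
rewrite [leLHS]big_mkcondr /= ler_sum // => v cv; case: ifP => [|_]; last first.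
  by rewrite mulrn_wge0.
rewrite negb_and -leNgt => /orP[gv|]; first by rewrite (le_trans gv) ?mulrn_wge0.
rewrite negb_forall => /existsP[u]; rewrite negb_imply negbK => /andP[uv Iu].
by rewrite -[leLHS]mulr1n ler_wpMn2l // card_gt0; apply/set0Pn; exists u; rewrite inE uv.
Qed.

End LocalRatio.

(** * Color reduction *)

Section ColeVishkin.
Local Open Scope nat_scope.

Definition bit i a := odd (a %/ 2 ^ i).

Lemma bit_inj m a b : a < 2 ^ m -> b < 2 ^ m ->
  (forall i, i < m -> bit i a = bit i b) -> a = b.
Proof.
elim: m a b => [|m IH] a b.
  by rewrite expn0 !ltnS !leqn0 => /eqP-> /eqP->.
rewrite expnSr => am bm eqb.
rewrite -[a]odd_double_half -[b]odd_double_half.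
have := eqb 0 isT; rewrite /bit expn0 !divn1 => ->.
congr (_ + _.*2); apply: IH => [||i im].
- by rewrite -divn2 ltn_divLR.
- by rewrite -divn2 ltn_divLR.
by have := eqb i.+1 im; rewrite /bit -!divn2 -!divnMA -expnS.
Qed.

(** The Cole-Vishkin step: the lowest position where [a] and [b] differ, with the bit of [a] there.
    The position is [m] if there is none below [m], which accounts for the two extra colors in
    [palette]. *)
Definition cv m a b :=
  let i := find (fun i => bit i a != bit i b) (iota 0 m) in i.*2 + bit i a.

Lemma cv_lt m a b : cv m a b < m.*2.+2.
Proof.
rewrite /cv; set i := find _ _.
have im : i <= m by rewrite -(size_iota 0 m) find_size.
rewrite -addn2 -addnS leq_add ?leq_double //.
by case: bit.
Qed.

Lemma cv_neq m a b c : a < 2 ^ m -> b < 2 ^ m -> a != b -> cv m a b != cv m b c.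
Proof.
move=> am bm; apply: contraNneq; rewrite /cv.
set i := find _ _; set j := find _ _ => E.
have ij : i = j.
  by have := congr1 half E; rewrite ![_.*2 + _]addnC !half_bit_double.
have := congr1 odd E; rewrite ![_.*2 + _]addnC -ij !oddD !odd_double !addbF !oddb.
move=> eqi; apply/eqP/(bit_inj am bm) => l lm; apply/eqP; apply: contraT => ne.
have h : has (fun i => bit i a != bit i b) (iota 0 m).
  by apply/hasP; exists l; rewrite ?mem_iota.
have := nth_find 0 h; rewrite nth_iota ?add0n; first by rewrite -/i eqi eqxx.
by rewrite -[X in _ < X](size_iota 0 m) -has_find.
Qed.

Fixpoint palette n k :=
  if k is k'.+1 then (up_log 2 (palette n k')).*2.+2 else n.

Fixpoint cvs n k (x : nat -> nat) :=
  if k is k'.+1 then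
    cv (up_log 2 (palette n k')) (cvs n k' x) (cvs n k' (fun i => x i.+1))
  else x 0.

Lemma eq_cvs n k x y : (forall i, i <= k -> x i = y i) -> cvs n k x = cvs n k y.
Proof.
elim: k x y => [|k IH] x y xy /=; first exact: xy.
by congr cv; apply: IH => i ik; apply: xy => //; apply: leqW.
Qed.

Lemma cvs_lt n k x : (forall i, x i < n) -> cvs n k x < palette n k.
Proof. by case: k => [|k] xn /=; [apply: xn | apply: cv_lt]. Qed.

(** Only the first two entries have to differ, since [cv_neq] admits any third entry: the sequence
    may become constant later on. *)
Lemma cvs_neq n k x : (forall i, x i < n) -> x 0 != x 1 ->
  cvs n k x != cvs n k (fun i => x i.+1).
Proof.
elim: k x => [//|k IH] x xn ne /=.
have bound y : (forall i, y i < n) -> cvs n k y < 2 ^ up_log 2 (palette n k).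
  by move=> yn; apply: leq_trans (cvs_lt k yn) _; apply: up_logP.
apply: cv_neq; [exact: bound | exact: bound | exact: IH].
Qed.

End ColeVishkin.

Lemma palette_log_star (R : realType) n : (0 < n)%N ->
  (palette n (log_star R n) <= 16)%N.
Proof.
move=> n0; rewrite /log_star; case: ex_minnP => K aK minK.
have ln2 : 0 < ln (2 : R) by rewrite ln_gt0 // ltr1n.
(* The constant 14 survives the recursion: for [a > 1], [2 * a + 14 <= 16 * a], whose binary
   logarithm is [4 + log2 a]. At [k = K] the iterate is at most 1, which gives 16. *)
suff H k : (k <= K)%N -> (palette n k)%:R <= 2 * iter k (@log2 R) n%:R + 14.
  rewrite -(ler_nat R) (le_trans (H K _)) //.
  by rewrite (natrD _ 2 14) lerD2r -[leRHS]mulr1 ler_pM2l.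
elim: k => [_|k IH kK].
  by rewrite /= -natrM -natrD ler_nat mul2n -addnn -addnA leq_addr.
have {IH} := IH (ltnW kK); rewrite iterS /=.
set a := iter k _ _; set N := palette n k => IH.
have a1 : 1 < a.
  by rewrite ltNge; apply/negP => /minK; rewrite leqNgt kK.
have la0 : 0 <= log2 a by apply: divr_ge0; [apply/ln_ge0/ltW | apply: ltW].
have [N1|N1] := leqP N 1.
  have -> : up_log 2 N = 0%N by apply/eqP; rewrite up_log_eq0 N1.
  by rewrite /= (@le_trans _ _ 14) ?ler_nat // lerDr mulr_ge0.
have := up_log_gtn (isT : (1 < 2)%N) N1.
have : (0 < up_log 2 N)%N by rewrite up_log_gt0.
case: (up_log 2 N) => // m _ /=; rewrite -(ltr_nat R) => mN.
have : m%:R <= 4 + log2 a.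
  rewrite /log2 -lerBlDl ler_pdivlMr // mulrBl lerBlDl !mulr_natl -!lnXn //.
  rewrite -lnM ?posrE ?exprn_gt0 //; last exact: lt_trans a1.
  rewrite ler_ln ?posrE ?mulr_gt0 ?exprn_gt0 //; last exact: lt_trans a1.
  rewrite -natrX (le_trans (ltW mN)) // (le_trans IH) //.
  have -> : 2 ^+ 4 = 2 + 14 :> R by rewrite -natrX -natrD.
  rewrite [leRHS]mulrDl lerD2l.
  by rewrite -[leLHS]mulr1 ler_pM2l // ltW.
move=> H; rewrite -muln2 -addn2 natrD natrM -natr1.
lra.
Qed.

(** * Linial's color reduction by polynomials over a finite field *)

Section Linial.
Variables (F : finFieldType) (I : finType) (q : nat) (e : 'I_q -> F).
Variables (V : finType) (B : V -> {set V}) (c : V -> {ffun I -> 'I_q}).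

Definition code (x : {ffun I -> 'I_q}) : {poly F} := Poly [seq e (x i) | i : I].

Definition separates v x :=
  [forall u, (u \in B v) ==> (c u != c v) ==> ((code (c u)).[x] != (code (c v)).[x])].

Definition recolor v : F * F :=
  let x := odflt 0 [pick x | separates v x] in (x, (code (c v)).[x]).

Hypothesis e_inj : injective e.

Lemma code_inj : injective code.
Proof.
move=> x y xy; apply/ffunP => i; apply: e_inj.
have := congr1 (fun p : {poly F} => p`_(enum_rank i)) xy.
by rewrite !coef_Poly !nth_image enum_rankK.
Qed.

Lemma card_code_eq x y : x != y ->
  (#|[set z | (code x).[z] == (code y).[z]]| <= #|I|)%N.
Proof.
move=> xy; set S := [set z | _].
have nz : code x - code y != 0.
  by rewrite subr_eq0; apply: contraNneq xy => /code_inj ->.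
have : (size (enum S) < size (code x - code y)%R)%N.
  apply: max_poly_roots => //; last exact: enum_uniq.
  by apply/allP => z; rewrite mem_enum inE rootE hornerD hornerN subr_eq0.
rewrite -cardE => /ltnW/leq_trans; apply.
apply: leq_trans (size_polyD _ _) _; rewrite size_polyN geq_max.
by apply/andP; split; apply: leq_trans (size_Poly _) _; rewrite size_image.
Qed.

Hypothesis cardF : forall v, (#|B v| * #|I| < #|F|)%N.

(** Union bound: each of the [#|B v|] vertices spoils at most [#|I|] points, the roots of the
    difference of two distinct polynomials of size at most [#|I|]. *)
Lemma separates_exists v : exists x, separates v x.
Proof.
apply: contrapT => none; have := cardF v; rewrite ltnNge => /negP; apply.
rewrite -(cardsT F).
pose bad u := if c u != c v then [set z | (code (c u)).[z] == (code (c v)).[z]] else set0.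
apply: (@leq_trans #|\bigcup_(u in B v) bad u|).
  apply/subset_leq_card/subsetP => x _; apply/bigcupP; apply: contrapT => H.
  apply: none; exists x; apply/forallP => u; apply/implyP => uB; apply/implyP => cu.
  by apply/negP => xu; apply: H; exists u => //; rewrite /bad cu inE.
have step u : (#|bad u| <= #|I|)%N.
  by rewrite /bad; case: ifP => [/card_code_eq//|]; rewrite cards0.
rewrite -sum_nat_const.
elim/big_rec2: _ => [|u s t _ st]; first by rewrite cards0.
exact: leq_trans (leq_card_setU _ _).1 (leq_add (step u) st).
Qed.

Lemma recolor_neq u v : u \in B v -> c u != c v -> recolor u != recolor v.
Proof.
move=> uv cuv; rewrite /recolor; case: (pickP (separates v)) => [x sx|none].
  apply/negP => /eqP[-> /= E]; have := forallP sx u.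
  by rewrite uv cuv E eqxx.
by have [x] := separates_exists v; rewrite none.
Qed.

End Linial.

(** * Local improvements of a matching *)

Section Mates.
Variables (R : realType) (n : nat) (G : wgraph R n).
Local Notation V := 'I_n.
Implicit Types (m o : V -> V) (x y u v : V).

Definition edge_wt x y : R := if adj G x y then wt G [set x; y] else 0.

(* A matching is represented by the involution exchanging matched vertices and
   fixing the others; [value] is twice the weight of the matching. *)
Definition mates m := involutive m /\ forall x, near G x (m x).

Definition value m : R := \sum_x edge_wt x (m x).

Lemma edge_wtxx x : edge_wt x x = 0.
Proof. by rewrite /edge_wt adj_irrefl. Qed.

Lemma mates_id : mates id.
Proof. by split=> // x; rewrite /near eqxx. Qed.

Section Improvement.
Hypothesis G_pos : positive_weights G.
Variables (m o : V -> V) (h : nat).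
Hypotheses (m_mates : mates m) (o_mates : mates o).

Let mK : involutive m := m_mates.1.
Let oK : involutive o := o_mates.1.

Lemma edge_wt_ge0 x y : 0 <= edge_wt x y.
Proof.
rewrite /edge_wt; case: ifP => // xy; apply/ltW/G_pos.
by apply/imset2P; exists x y; rewrite ?inE.
Qed.

Definition orbit_pt i v := iter i (o \o m) v.

(* The walk v, m v, o (m v), m (o (m v)), ... bounces at the ends of alternating
   paths, so near an end its points repeat.  Every step is a bijection in v, so
   the visits with multiplicity are equidistributed; switching from m to o on
   each level set of the multiplicity therefore counts all edges equally. *)
Definition visits v x : nat :=
  (\sum_(i < h.+1) ((orbit_pt i v == x) + (m (orbit_pt i v) == x)))%N.

(** The same walk without its first and last points, paired along [o] instead of [m]. This makes the
    count invariant under [o]. *)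
Definition inner v x : nat :=
  (\sum_(i < h) ((m (orbit_pt i v) == x) + (orbit_pt i.+1 v == x)))%N.

Definition switch v j x :=
  if (j < visits v x)%N then if (j < visits v (o x))%N then o x else x else m x.

Lemma visits_m v x : visits v (m x) = visits v x.
Proof.
apply: eq_bigr => i _.
rewrite (inj_eq (inv_inj mK)) addnC; congr (_ + nat_of_bool _)%N.
by rewrite -(inj_eq (inv_inj mK)) mK.
Qed.

Lemma inner_o v x : inner v (o x) = inner v x.
Proof.
apply: eq_bigr => i _; rewrite /orbit_pt /= (inj_eq (inv_inj oK)) addnC.
by rewrite -[m _ == o x](inj_eq (inv_inj oK)) oK.
Qed.

Lemma inner_visits v x : (inner v x <= visits v x)%N.
Proof.
rewrite /inner /visits !big_split /= addnC leq_add //.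
  by rewrite [leqRHS]big_ord_recl leq_addl.
by rewrite [leqRHS]big_ord_recr leq_addr.
Qed.

Lemma visits_le v x : (visits v x <= h.+1.*2)%N.
Proof.
rewrite -muln2 -[X in (_ <= X * _)%N](card_ord h.+1) -sum_nat_const leq_sum // => i _.
by rewrite (leq_add (leq_b1 _) (leq_b1 _)).
Qed.

(** The level sets of [visits v] are closed under [m], so [o] inside and [m] outside do not
    interfere; a vertex of the level set whose [o]-partner lies outside becomes unmatched. *)
Lemma switch_mates v j : mates (switch v j).
Proof.
split=> x; rewrite /switch.
  have [jx|jx] := ltnP j (visits v x); last by rewrite visits_m ltnNge jx mK.
  have [jo|jo] := ltnP j (visits v (o x)); first by rewrite jo oK jx.
  by rewrite jx ltnNge jo.
case: ifP => _; last exact: m_mates.2.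
by case: ifP => _; [apply: o_mates.2 | rewrite /near eqxx].
Qed.

Lemma orbit_pt_ball i v : orbit_pt i v \in ball G i.*2 v.
Proof.
elim: i => [|i IH]; first by rewrite inE.
rewrite doubleS -addn2; apply: (ball_trans IH).
apply: (@ball_trans _ _ _ 1 1 _ _ (m (orbit_pt i v))); rewrite ball1.
  exact: m_mates.2.
exact: o_mates.2.
Qed.

Lemma switch_out v j x : x \notin ball G h.+1.*2 v -> switch v j x = m x.
Proof.
move=> xB; rewrite /switch; suff -> : visits v x = 0%N by [].
rewrite /visits big1 // => i _; apply/eqP; rewrite addn_eq0 !eqb0.
have zB : orbit_pt i v \in ball G i.*2 v by apply: orbit_pt_ball.
have le_i : (i.*2.+1 <= h.+1.*2)%N by rewrite ltn_double ltn_ord.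
apply/andP; split; apply: contraNneq xB => <-; apply: (subsetP (subset_ball _ _ le_i)).
  exact: (subsetP (subset_ball _ _ (leqnSn _))).
by rewrite -[i.*2.+1]addn1; apply: (ball_trans zB); rewrite ball1; apply: m_mates.2.
Qed.

Lemma sum_ltn N a : (a <= N)%N -> (\sum_(j < N) (j < a) = a)%N.
Proof.
move=> aN; rewrite -[RHS](card_ord a) -sum1_card -(big_mkord predT (fun=> 1%N)).
rewrite (big_nat_widen _ _ _ _ _ aN) /= big_mkord [RHS]big_mkcond.
by apply: eq_bigr => j _; case: ltnP.
Qed.

Lemma sum_switch v :
  \sum_(j < h.+1.*2) (value (switch v j) - value m) =
  \sum_x (edge_wt x (o x) *+ minn (visits v x) (visits v (o x))
          - edge_wt x (m x) *+ visits v x).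
Proof.
under eq_bigr => j _ do rewrite -sumrB.
rewrite exchange_big /=; apply: eq_bigr => x _.
set a := visits v x; set b := visits v (o x).
transitivity (\sum_(j < h.+1.*2)
   (edge_wt x (o x) *+ (j < minn a b)%N - edge_wt x (m x) *+ (j < a)%N)).
  apply: eq_bigr => j _; rewrite /switch leq_min -/a -/b.
  case: ifP => _ /=; last by rewrite !mulr0n !subrr.
  by case: ifP => _; rewrite ?mulr0n mulr1n // edge_wtxx.
rewrite sumrB; congr (_ - _); rewrite sumrMnr sum_ltn ?visits_le //.
by rewrite geq_min visits_le.
Qed.

Lemma sum_eq_inj (f : V -> V) x : injective f -> (\sum_v (f v == x) = 1)%N.
Proof.
move=> f_inj.
rewrite -(reindex_inj f_inj (P := predT) (F := fun v => nat_of_bool (v == x))) /=.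
by rewrite (bigD1 x) //= eqxx big1 // => v /negPf->.
Qed.

Lemma orbit_pt_inj i : injective (orbit_pt i).
Proof. by elim: i => [//|i IH] u v /(inv_inj oK)/(inv_inj mK)/IH. Qed.

Lemma sum_visits x : (\sum_v visits v x = h.+1.*2)%N.
Proof.
rewrite exchange_big /= -muln2 -[X in (X * _)%N](card_ord h.+1) -sum_nat_const.
apply: eq_bigr => i _; rewrite big_split /= sum_eq_inj; last exact: orbit_pt_inj.
by rewrite (@sum_eq_inj (m \o orbit_pt i)) //; apply/inj_comp/orbit_pt_inj/inv_inj.
Qed.

Lemma sum_inner x : (\sum_v inner v x = h.*2)%N.
Proof.
rewrite exchange_big /= -muln2 -[X in (X * _)%N](card_ord h) -sum_nat_const.
apply: eq_bigr => i _; rewrite big_split /= [X in (_ + X)%N]sum_eq_inj; last first.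
  exact: (@orbit_pt_inj i.+1).
by rewrite (@sum_eq_inj (m \o orbit_pt i)) //; apply/inj_comp/orbit_pt_inj/inv_inj.
Qed.

(** Over all [v] and [j], each [x] loses its [m]-edge exactly [h.+1.*2] times. It gets its [o]-edge
    at least [h.*2] times, as [inner v] takes the same value at [x] and [o x] and is below
    [visits v] at both. *)
Lemma sum_switch_ge :
  value o *+ h.*2 - value m *+ h.+1.*2 <=
  \sum_v \sum_(j < h.+1.*2) (value (switch v j) - value m).
Proof.
under eq_bigr => v _ do rewrite sum_switch.
rewrite exchange_big /= /value -!sumrMnl -sumrB ler_sum // => x _.
rewrite sumrB lerB //; last by rewrite sumrMnr sum_visits.
rewrite -(sum_inner x) -sumrMnr ler_sum // => v _.
by rewrite ler_wpMn2l ?edge_wt_ge0 // leq_min inner_visits -inner_o inner_visits.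
Qed.

End Improvement.

(** * Best replacements inside balls, and rounds of disjoint replacements *)

Section Round.
Variable L : nat.
Local Notation B := (ball G L).

(** An [m]-edge leaving the ball must be kept, which lets replacements in disjoint balls coexist.
    Outside the ball [f] is the identity rather than [m], so that the condition involves [m] inside
    the ball only. *)
Definition cand m v (f : {ffun V -> V}) : bool :=
  [forall x, if x \in B v then
     if m x \in B v then [&& f x \in B v, near G x (f x) & f (f x) == x]
     else f x == m x
   else f x == x].

Definition crop m v : {ffun V -> V} := [ffun x => if x \in B v then m x else x].

Definition best m v : {ffun V -> V} :=
  [arg max_(f > crop m v | cand m v f) \sum_(x in B v) edge_wt x (f x)]%O.

Definition gain m v : R :=
  \sum_(x in B v) edge_wt x (best m v x) - \sum_(x in B v) edge_wt x (m x).

Definition update m (I : V -> bool) x :=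
  if [pick v | (v \in B x) && I v] is Some v then best m v x else m x.

Lemma cand_crop m m' v : mates m -> mates m' ->
  (forall x, x \notin B v -> m' x = m x) -> cand m v (crop m' v).
Proof.
move=> [mK mG] [m'K m'G] out; apply/forallP => x; rewrite !ffunE.
case xB: (x \in B v); last by rewrite eqxx.
case: ifP => mxB.
  have m'xB : m' x \in B v.
    apply: contraT => m'xB; have := out _ m'xB; rewrite m'K => xE.
    by move: mxB; rewrite {1}xE mK (negPf m'xB).
  by rewrite m'xB m'G m'K /= eqxx.
by apply/eqP; have := out (m x); rewrite mxB mK => /(_ isT) E; rewrite -{1}E m'K.
Qed.

Lemma best_cand m v : mates m -> cand m v (best m v).
Proof.
by move=> mm; rewrite /best; case: Order.TotalTheory.arg_maxP => //; apply: cand_crop.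
Qed.

Lemma gain_ge m m' v : mates m -> mates m' ->
  (forall x, x \notin B v -> m' x = m x) -> value m' - value m <= gain m v.
Proof.
move=> mm mm' out; rewrite /value (bigID (fun x => x \in B v)) /=.
rewrite [X in _ - X](bigID (fun x => x \in B v)) /=.
rewrite (eq_bigr (fun x => edge_wt x (m x)) (P := fun x => x \notin B v)); last first.
  by move=> x /out->.
rewrite opprD addrACA subrr addr0 lerD2r /best.
case: Order.TotalTheory.arg_maxP => [|f _ /(_ _ (cand_crop mm mm' out))].
  exact: cand_crop.
apply: le_trans; rewrite (eq_bigr (fun x => edge_wt x (crop m' v x))) //.
by move=> x xB; rewrite ffunE xB.
Qed.

Lemma gain_ge0 m v : mates m -> 0 <= gain m v.
Proof. by move=> mm; rewrite -[leLHS](subrr (value m)); apply: gain_ge. Qed.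

Section Update.
Variables (m : V -> V) (I : V -> bool).
Hypothesis m_mates : mates m.
Hypothesis I_indep : forall u v, I u -> I v -> u \in ball G (L + L) v -> u = v.

Lemma center_uniq x u v : I u -> I v -> x \in B u -> x \in B v -> u = v.
Proof.
by move=> Iu Iv xu xv; apply: I_indep => //; apply: ball_trans xv _; rewrite ball_sym.
Qed.

Variant update_spec x : V -> Prop :=
  | UpdateIn v of I v & x \in B v : update_spec x (best m v x)
  | UpdateOut of (forall v, I v -> x \notin B v) : update_spec x (m x).

Lemma updateP x : update_spec x (update m I x).
Proof.
rewrite /update; case: pickP => [v /andP[vx Iv]|none].
  by apply: UpdateIn => //; rewrite ball_sym.
by apply: UpdateOut => v Iv; rewrite ball_sym; have := none v; rewrite Iv andbT => ->.
Qed.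

Lemma update_in x v : I v -> x \in B v -> update m I x = best m v x.
Proof.
move=> Iv xv; case: updateP => [u Iu xu|/(_ _ Iv)]; last by rewrite xv.
by rewrite (center_uniq Iu Iv xu xv).
Qed.

Lemma best_in v x : x \in B v -> m x \in B v ->
  [&& best m v x \in B v, near G x (best m v x) & best m v (best m v x) == x].
Proof. by move=> xv mxv; have := forallP (best_cand v m_mates) x; rewrite xv mxv. Qed.

Lemma best_out v x : x \in B v -> m x \notin B v -> best m v x = m x.
Proof.
by move=> xv mxv; have := forallP (best_cand v m_mates) x; rewrite xv (negPf mxv) => /eqP.
Qed.

Lemma update_back x : (forall v, I v -> m x \in B v -> x \notin B v) ->
  update m I (m x) = x.
Proof.
move=> out; case: updateP => [v Iv mxv|_]; last exact: m_mates.1.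
by rewrite best_out // ?m_mates.1 // out.
Qed.

(** If an [m]-edge leaves a chosen ball, both ends keep their partner: [best] respects such an edge
    on either side, even when the other end lies in another chosen ball. *)
Lemma update_mates : mates (update m I).
Proof.
split=> x; case: (updateP x) => [v Iv xv|out].
- have [mxv|mxv] := boolP (m x \in B v).
    by case/and3P: (best_in xv mxv) => fB _ /eqP ff; rewrite (update_in Iv fB).
  rewrite (best_out xv mxv) update_back // => u Iu mxu.
  by apply: contra mxv => xu; rewrite (center_uniq Iv Iu xv xu).
- by rewrite update_back // => v /out.
- have [mxv|mxv] := boolP (m x \in B v); last by rewrite best_out // m_mates.2.
  by case/and3P: (best_in xv mxv).
- exact: m_mates.2.
Qed.

Lemma value_update : value (update m I) = value m + \sum_(v | I v) gain m v.
Proof.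
apply/eqP; rewrite addrC -subr_eq /value -sumrB; apply/eqP.
rewrite /gain; under [RHS]eq_bigr => v _ do rewrite -sumrB.
rewrite (exchange_big_dep predT) //=; apply: eq_bigr => x _.
case: updateP => [v Iv xv|out].
  rewrite (big_pred1 v) // => u; apply/andP/eqP => [[Iu xu]|->//].
  exact: center_uniq xu xv.
by rewrite subrr big1 // => v /andP[/out/negPf->].
Qed.

End Update.

Section Rounds.
Hypothesis G_pos : positive_weights G.
Variables (C : finType) (col : V -> C) (D : nat).
Hypothesis col_proper :
  forall u v, u \in ball G (L + L) v -> col u = col v -> u = v.
Hypothesis D_ball : forall v, (#|ball G (L + L) v| <= D)%N.

Definition round m := update m (select (ball G (L + L)) col (enum C) (gain m)).

Lemma round_indep m : mates m ->
  let I := select (ball G (L + L)) col (enum C) (gain m) in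
  forall u v, I u -> I v -> u \in ball G (L + L) v -> u = v.
Proof.
move=> mm I u v Iu Iv; apply: (select_indep _ col_proper _ Iu Iv) => [x y|x].
  exact: ball_sym.
exact: gain_ge0.
Qed.

Lemma round_mates m : mates m -> mates (round m).
Proof. by move=> mm; apply: update_mates => //; apply: round_indep. Qed.

(** Each of the [L] switches at [v] changes [m] only in the ball of radius [L], so it gains at most
    [gain m v]; the selection then keeps a fraction [1 / D] of the total gain. *)
Lemma round_gain m o h : L = h.+1.*2 -> mates m -> mates o ->
  value o *+ h.*2 - value m *+ L <= (value (round m) - value m) *+ (L * D).
Proof.
move=> LE mm om; rewrite (@value_update m) ?(addrC (value m)) ?addrK; last first.
  exact: round_indep.
apply: (@le_trans _ _ ((\sum_v gain m v) *+ L)); last first.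
  rewrite mulnC mulrnA lerMn2r; apply/orP; right; rewrite -mulr_natl.
  apply: select_total => // [v|u v|v|v _].
  - exact: ball_refl.
  - exact: ball_sym.
  - exact: gain_ge0.
  - by rewrite mem_enum.
rewrite {1}LE (le_trans (sum_switch_ge G_pos _ mm om)) // -sumrMnl ler_sum // => v _.
have -> : gain m v *+ L = \sum_(j < h.+1.*2) gain m v.
  by rewrite sumr_const card_ord -LE.
rewrite ler_sum // => j _.
apply: gain_ge => //; first exact: switch_mates.
by move=> x xB; apply: switch_out => //; rewrite -LE.
Qed.

End Rounds.
End Round.
End Mates.

(** * Convergence *)

Section Convergence.
Variables (R : realType) (n : nat) (G : wgraph R n) (k : nat).
Local Notation V := 'I_n.
Hypothesis G_pos : positive_weights G.
Hypothesis k_gt0 : (0 < k)%N.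
Let L := (4 * k)%N.
Variables (C : finType) (col : V -> C) (D : nat).
Hypothesis col_proper :
  forall u v, u \in ball G (L + L) v -> col u = col v -> u = v.
Hypothesis D_ball : forall v, (#|ball G (L + L) v| <= D)%N.
Hypothesis D_gt0 : (0 < D)%N.

Let M t := iter t (@round R n G L C col) id.

Lemma iter_round_mates t : mates G (M t).
Proof.
elim: t => [|t IH] /=; first exact: mates_id.
exact: round_mates.
Qed.

(** With [L = 4 * k], [goal] is [(L - 2) / L] times the value of [o], the point up to which
    [round_gain] forces progress. A round multiplies a positive gap by at most [1 - 1 / D]; the
    weaker decay [D / (D + t)] follows and keeps the arithmetic rational. *)
Lemma gap_decay o t : mates G o ->
  let goal := value G o * (2 * k%:R - 1) / (2 * k%:R) in
  (goal - value G (M t)) * (D%:R + t%:R) <= goal * D%:R.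
Proof.
move=> om; set goal := _ / _; rewrite /=.
have k1 : 1 <= k%:R :> R by rewrite ler1n.
have D1 : 1 <= D%:R :> R by rewrite ler1n.
have o0 : 0 <= value G o by apply: sumr_ge0 => x _; apply: edge_wt_ge0.
have goal0 : 0 <= goal.
  apply: divr_ge0; last by lra.
  by apply: mulr_ge0 => //; lra.
elim: t => [|t IH].
  rewrite addr0 ler_wpM2r //.
  have -> : value G (M 0) = 0 by apply: big1 => x _; apply: edge_wtxx.
  by rewrite subr0.
have LE : L = (2 * k).-1.+1.*2.
  by rewrite prednK ?muln_gt0 // -muln2 mulnAC.
have := round_gain G_pos col_proper D_ball LE (iter_round_mates t) om.
rewrite -/(M t.+1); set v := value G (M t); set v' := value G (M t.+1) => gain.
have step : goal - v <= (v' - v) * D%:R.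
  have L0 : 0 < L%:R :> R by rewrite ltr0n muln_gt0.
  rewrite -(ler_pM2r L0); move: gain; rewrite -(mulr_natr (value G o)).
  rewrite -(mulr_natr v) -(mulr_natr (v' - v)) natrM.
  have -> : (2 * k).-1.*2%:R = 2 * (2 * k%:R - 1) :> R.
    by rewrite -subn1 -mul2n natrM natrB ?muln_gt0 // natrM.
  have -> : L%:R = 2 * (2 * k%:R) :> R by rewrite -!natrM mulnA.
  have -> : value G o * (2 * (2 * k%:R - 1)) = goal * (2 * (2 * k%:R)).
    rewrite mulrCA [RHS]mulrCA; congr (_ * _).
    by rewrite /goal divfK // mulf_neq0 // gt_eqF //; lra.
  lra.
rewrite -natr1; have t0 : 0 <= t%:R :> R by [].
move: IH step D1 t0 goal0; rewrite -/v.
have -> : v' - v = (goal - v) - (goal - v') by lra.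
move: (goal - v) (goal - v') => g g' IH step D1 t0 goal0.
have [g'0|g'0] := leP g' 0.
  apply: (@le_trans _ _ 0); last by apply: mulr_ge0 => //; lra.
  by apply: mulr_le0_ge0 => //; lra.
have gD : g' * D%:R <= g * (D%:R - 1) by lra.
have g0 : 0 <= g.
  rewrite leNgt; apply/negP => g0.
  have : 0 < g' * D%:R by apply: mulr_gt0 => //; lra.
  have : g * (D%:R - 1) <= 0 by apply: mulr_le0_ge0; lra.
  lra.
have D0 : 0 < D%:R :> R by lra.
rewrite -(ler_pM2r D0).
apply: (@le_trans _ _ (g * (D%:R - 1) * (D%:R + (t%:R + 1)))).
  rewrite mulrAC ler_wpM2r //; lra.
apply: (@le_trans _ _ (g * (D%:R + t%:R) * D%:R)).
  rewrite -!mulrA ler_wpM2l //; nra.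
by rewrite ler_wpM2r // ltW.
Qed.

(** After [2 * k * D] rounds the gap is at most [goal / (2 * k + 1)], so the ratio is at least [(2 *
    k - 1) / (2 * k + 1) >= 1 - 1 / k >= 1 - eps]. *)
Lemma iter_round_approx o eps : mates G o -> 1 <= k%:R * eps ->
  (1 - eps) * value G o <= value G (M (2 * k * D)).
Proof.
move=> om keps; have := gap_decay (2 * k * D) om; rewrite /=.
set v := value G (M _); set w := value G o.
have w0 : 0 <= w by apply: sumr_ge0 => x _; apply: edge_wt_ge0.
have D0 : 0 < D%:R :> R by rewrite ltr0n.
have k1 : 1 <= k%:R :> R by rewrite ler1n.
rewrite !natrM -[X in _ * (X + _)]mul1r -mulrDl mulrA ler_pM2r //.
set K : R := k%:R in k1 keps *.
set g := w * _ / _.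
have gE : g * (2 * K) = w * (2 * K - 1).
  by rewrite /g divfK // gt_eqF //; lra.
move=> H.
have H2 : w * (2 * K - 1) <= v * (1 + 2 * K) by nra.
have K0 : 0 < 1 + 2 * K by lra.
rewrite -(ler_pM2r K0); apply: le_trans H2.
rewrite [(1 - eps) * w]mulrC -mulrA ler_wpM2l //; nra.
Qed.

End Convergence.

(** * Matchings as edge sets and as involutions *)

Section MatchingsAsMates.
Variables (R : realType) (n : nat) (G : wgraph R n).
Local Notation V := 'I_n.

Definition edge_set (m : V -> V) : {set {set V}} :=
  [set [set x; m x] | x in [pred x | m x != x]].

Lemma card_edge e : e \in edges G -> #|e| = 2%N.
Proof.
case/imset2P => x y _; rewrite inE => /andP[_ xy] ->; rewrite cards2.
by case: eqP xy => // ->; rewrite adj_irrefl.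
Qed.

Lemma adj_edge x y : adj G x y -> [set x; y] \in edges G.
Proof. by move=> xy; apply/imset2P; exists x y; rewrite ?inE. Qed.

Lemma edge_adj x y : x != y -> [set x; y] \in edges G -> adj G x y.
Proof.
move=> nxy /imset2P[u v _]; rewrite inE => /andP[_ uv] E.
have : x \in [set u; v] by rewrite -E set21.
have : y \in [set u; v] by rewrite -E set22.
rewrite !inE => /orP[]/eqP yE /orP[]/eqP xE; move: nxy; rewrite xE yE ?eqxx //.
by rewrite adj_sym.
Qed.

Lemma mates_adj m x : mates G m -> m x != x -> adj G x (m x).
Proof. by move=> [_ /(_ x)]; rewrite /near eq_sym => /orP[->|]. Qed.

(** Evaluating [m] at either endpoint decides membership of an edge; this is how queries are
    answered. *)
Lemma mem_edge_set m e u : mates G m -> e \in edges G -> u \in e ->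
  (e \in edge_set m) = (e == [set u; m u]).
Proof.
move=> mm eG ue; apply/imsetP/eqP => [[x _ eE]|eE].
  by move: ue; rewrite eE !inE => /orP[]/eqP->//; rewrite mm.1 setUC.
exists u => //; rewrite inE; apply/eqP => mu.
by have := card_edge eG; rewrite eE mu setUid cards1.
Qed.

Lemma edge_set_edges m : mates G m -> edge_set m \subset edges G.
Proof.
move=> mm; apply/subsetP => e /imsetP[x]; rewrite inE => mx ->.
exact/adj_edge/mates_adj.
Qed.

Lemma edge_set_matching m : mates G m -> matching G (edge_set m).
Proof.
move=> mm; have sub := edge_set_edges mm; rewrite /matching sub /=.
apply/trivIsetP => e f eM fM; apply: contraR => /pred0Pn[u /andP[/= ue uf]].
have /eqP-> : e == [set u; m u] by rewrite -(mem_edge_set mm) // (subsetP sub).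
by rewrite eq_sym -(mem_edge_set mm) // (subsetP sub).
Qed.

Lemma value_edge_set m : mates G m -> value G m = weight G (edge_set m) *+ 2.
Proof.
move=> mm; have sub := edge_set_edges mm.
rewrite /value (bigID (fun x => m x != x)) /= [X in _ + X]big1 ?addr0; last first.
  by move=> x; rewrite negbK => /eqP->; apply: edge_wtxx.
rewrite (partition_big (fun x => [set x; m x]) (mem (edge_set m))) /=; last first.
  by move=> x mx; apply/imsetP; exists x.
rewrite /weight -sumrMnl; apply: eq_bigr => e eM.
have eG := subsetP sub _ eM.
rewrite (eq_bigr (fun=> wt G e)); last first.
  by move=> x /andP[mx /eqP<-]; rewrite /edge_wt mates_adj.
rewrite -(card_edge eG) -sumr_const; apply: eq_bigl => x.
apply/andP/idP => [[_ /eqP<-]|xe]; first by rewrite set21.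
have := mem_edge_set mm eG xe; rewrite eM => /esym/eqP eE.
rewrite -eE eqxx; split=> //; apply/eqP => mx.
by have := card_edge eG; rewrite eE mx setUid cards1.
Qed.

Definition mate_of (M : {set {set V}}) x :=
  odflt x [pick y | (y != x) && ([set x; y] \in M)].

Lemma matching_uniq M e f x : matching G M -> e \in M -> f \in M ->
  x \in e -> x \in f -> e = f.
Proof.
case/andP => _ /trivIsetP tM eM fM xe xf; apply/eqP; apply: contraT => /(tM _ _ eM fM).
by move/pred0Pn => []; exists x; rewrite /= xe.
Qed.

Lemma set2_inj (x y z : V) : [set x; y] = [set x; z] -> y != x -> y = z.
Proof. by move=> E yx; have := set22 x y; rewrite E !inE (negPf yx) => /eqP. Qed.

Lemma mate_ofP M x y : matching G M -> y != x -> [set x; y] \in M -> mate_of M x = y.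
Proof.
move=> MM yx xyM; rewrite /mate_of; case: pickP => [z /andP[zx xzM]|/(_ y)].
  apply: set2_inj zx; apply: (matching_uniq (x := x) MM) => //; exact: set21.
by rewrite yx xyM.
Qed.

Lemma mate_of_mates M : matching G M -> mates G (mate_of M).
Proof.
move=> MM; split=> x.
  rewrite [X in mate_of M X]/mate_of; case: pickP => [y /andP[yx xyM]|none] /=.
    by apply: mate_ofP; rewrite // 1?eq_sym // setUC.
  by rewrite /mate_of; case: pickP => //= y; rewrite none.
rewrite /mate_of /near; case: pickP => [y /andP[yx xyM]|_] /=; last by rewrite eqxx.
rewrite (@edge_adj x y) ?orbT // 1?eq_sym //.
by case/andP: MM => /subsetP/(_ _ xyM).
Qed.

Lemma edge_set_mate_of M : matching G M -> edge_set (mate_of M) = M.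
Proof.
move=> MM; have mm := mate_of_mates MM; apply/setP => e; apply/idP/idP.
  case/imsetP => x; rewrite inE => mx ->; move: mx; rewrite /mate_of.
  by case: pickP => [y /andP[]//|]; rewrite eqxx.
move=> eM; have eG : e \in edges G by case/andP: MM => /subsetP/(_ _ eM).
case/imset2P: (eG) eM => x y _; rewrite inE => /andP[_ xy] -> xyM.
have yx : y != x by apply: contraTneq xy => ->; rewrite adj_irrefl.
by apply/imsetP; exists x; rewrite ?inE (mate_ofP MM yx xyM).
Qed.

Lemma mates_approx_mwm m eps : mates G m ->
  (forall o, mates G o -> (1 - eps) * value G o <= value G m) ->
  approx_mwm G eps (edge_set m).
Proof.
move=> mm H; split=> [|M [MM _]]; first exact: edge_set_matching.
have := H _ (mate_of_mates MM).
by rewrite !value_edge_set ?edge_set_mate_of //; [lra | exact: mate_of_mates].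
Qed.

End MatchingsAsMates.

(** * Locality of the rounds *)

Section LocalAlgorithm.
Variables (R : realType) (n d : nat).
Local Notation V := 'I_n.
Local Notation graph := (wgraph R n).
Local Notation local := (@local R n d).

Definition edge_row (G : graph) (v : V) := (adj G v : V -> bool, edge_wt G v).

Lemma local_edge_row : local edge_row d.
Proof.
apply: (local_det (fun=> false, fun=> 0) (local_probes R n d d)) => G G' v Gd G'd.
move=> /eq_in_map E.
have sub (H H' : graph) : (maxdeg H <= d)%N ->
    (forall i, (i < d)%N -> probe H v i = probe H' v i) ->
    forall y, adj H v y -> adj H' v y /\ wt H [set v; y] = wt H' [set v; y].
  move=> Hd pE y; rewrite -ports_adj => yv.
  have i_lt : (index y (ports H v) < size (ports H v))%N by rewrite index_mem.
  have := pE (index y (ports H v)); rewrite (leq_trans i_lt); last first.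
    exact: leq_trans (size_ports H v) Hd.
  rewrite /probe i_lt nth_index // => /(_ isT); case: ltnP => // i_lt' [yE wE _].
  split; last by rewrite {2}yE.
  by rewrite -ports_adj yE mem_nth.
have pE i : (i < d)%N -> probe G v i = probe G' v i.
  by move=> id; apply: E; rewrite mem_iota.
have sub1 := sub G G' Gd pE.
have sub2 := sub G' G G'd (fun i id => esym (pE i id)).
have adjE y : adj G v y = adj G' v y.
  by apply/idP/idP => [/sub1[]|/sub2[]].
congr (_, _); apply/funext => y //; rewrite /edge_wt adjE.
by case: ifP => // /sub2[_ ->].
Qed.

(** * Coloring the power graph with few probes *)

Section Coloring.
Variable r : nat.
Local Notation label := (r.-tuple 'I_d.+1).
Local Notation K := (log_star R n).

Definition chain_color (G : graph) (s : label) (v : V) : nat :=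
  cvs n K (fun i => iter i (fun u => walk G u s) v).

Definition vec (G : graph) (v : V) : {ffun label -> 'I_16} :=
  [ffun s => inord (chain_color G s v)].

(** For a label [s] leading from [v] to [u], the iterates seen from [u] are those seen from [v]
    shifted by one, so [cvs_neq] tells the two entries at [s] apart. *)
Lemma vec_neq G u v : (maxdeg G <= d)%N -> u \in ball G r v -> u != v ->
  vec G u != vec G v.
Proof.
move=> Gd uv; rewrite eq_sym; apply: contra => /eqP vE.
have [s sE] := ball_walk Gd uv.
have n0 : (0 < n)%N := leq_ltn_trans (leq0n v) (ltn_ord v).
have lt16 w : (chain_color G s w < 16)%N.
  apply: leq_trans (palette_log_star R n0); apply: cvs_lt => i; exact: ltn_ord.
have := congr1 (fun f : {ffun label -> 'I_16} => nat_of_ord (f s)) vE.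
rewrite /= !ffunE !inordK // => E; apply: contraT => nvu.
pose x i : nat := iter i (fun u => walk G u s) v.
have := @cvs_neq n K x (fun i => ltn_ord _); rewrite /x /= sE => /(_ nvu).
move/eqP; case; rewrite -/(chain_color G s v) -E /chain_color -sE.
by apply: eq_cvs => i _; rewrite -iterSr.
Qed.

Lemma local_vec : local vec (d.+1 ^ r * (K.+1 * r)).
Proof.
rewrite -[X in (X ^ _ * _)%N]card_ord -card_tuple cardE.
apply: (local_det [ffun=> ord0] (local_collect (enum {: label})
  (fun s => local_traject K.+1 (local_walk R n s)))) => G G' v _ _ /eq_in_map E.
apply/ffunP => s; rewrite !ffunE; congr inord; apply: eq_cvs => i iK; congr val.
have := E s; rewrite mem_enum => /(_ isT) Es.
by rewrite -!(@nth_traject _ _ i K.+1) // Es.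
Qed.

Variables (F : finFieldType) (e : 'I_16 -> F).

Definition color (G : graph) : V -> F * F := recolor e (ball G r) (vec G).

Lemma local_color : local color (d.+1 ^ r * (r + d.+1 ^ r * (K.+1 * r))).
Proof.
apply: (local_ball (0, 0) local_vec) => G G' v bE vE.
have vv : vec G v = vec G' v by apply/vE/ball_refl.
rewrite /color /recolor vv.
have -> // : separates e (ball G r) (vec G) v = separates e (ball G' r) (vec G') v.
apply/funext => x; apply: eq_forallb => u; rewrite -bE vv.
by have [/vE->|//] := boolP (u \in ball G r v).
Qed.

Hypothesis e_inj : injective e.
Hypothesis cardF : (d.+1 ^ r * d.+1 ^ r < #|F|)%N.

Lemma color_proper G u v : (maxdeg G <= d)%N -> u \in ball G r v ->
  color G u = color G v -> u = v.
Proof.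
move=> Gd uv cE; apply/eqP; apply: contraT => nuv.
suff : color G u != color G v by rewrite cE eqxx.
apply: recolor_neq => // [w|]; last exact: vec_neq.
apply: leq_ltn_trans cardF; rewrite card_tuple card_ord leq_mul2r.
by rewrite card_ball ?orbT.
Qed.

End Coloring.

(** * Probe counts of the selection and of the rounds *)

Section Levels.
Variables (L Q : nat) (C : finType) (col : graph -> V -> C).
Let r := (L + L)%N.
Let b := (4 * d.+1 ^ r)%N.
Hypothesis rQ : (r <= Q)%N.

(** [e] counts nested ball explorations. Each costs a factor [b]: there are at most [d.+1 ^ r]
    walks, each followed by up to three maps at its end, and the walk itself is charged as a fourth.
    [Q] is the cost at level 0. *)
Definition at_level S e (f : graph -> V -> S) := local f (b ^ e * Q).

Lemma at_levelW S e e' (f : graph -> V -> S) : (e <= e')%N ->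
  at_level e f -> at_level e' f.
Proof.
move=> ee; apply: local_le; rewrite leq_mul2r leq_pexp2l ?orbT //.
by rewrite /b muln_gt0 expn_gt0.
Qed.

Lemma at_level_ball S1 S2 S3 T e k (f1 : graph -> V -> S1) (f2 : graph -> V -> S2)
    (f3 : graph -> V -> S3) (g : graph -> V -> T) (y0 : T) : (k <= r)%N ->
  at_level e f1 -> at_level e f2 -> at_level e f3 ->
  (forall G G' v, ball G k v = ball G' k v ->
     (forall u, u \in ball G k v ->
        [/\ f1 G u = f1 G' u, f2 G u = f2 G' u & f3 G u = f3 G' u]) ->
     g G v = g G' v) ->
  at_level e.+1 g.
Proof.
move=> kr L1 L2 L3 det.
have /local_le : local g (d.+1 ^ k * (k + (b ^ e * Q + b ^ e * Q + b ^ e * Q))).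
  apply: (local_ball y0 (local_pair (local_pair L1 L2) L3)) => G G' v bE fE.
  by apply: (det _ _ _ bE) => u /fE[-> -> ->].
apply.
have rb : (r <= b ^ e * Q)%N.
  by apply: leq_trans rQ _; rewrite leq_pmull // expn_gt0 /b muln_gt0 expn_gt0.
apply: (@leq_trans (d.+1 ^ r * (4 * (b ^ e * Q)))%N); last first.
  by rewrite expnS /b; lia.
by apply: leq_mul; [rewrite leq_pexp2l | lia].
Qed.

Hypothesis col_level : at_level 0 col.
Hypothesis edge_row_level : at_level 0 edge_row.

(** Each color takes two levels: one to compute the residuals and one to see which neighbors the
    later colors have selected. *)
Lemma select_level cs e (g : graph -> V -> R) : at_level e g ->
  at_level (e + 2 * size cs) (fun G => select (ball G r) (col G) cs (g G)).
Proof.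
elim: cs e g => [|c cs IH] e g Lg /=.
  by apply: local_le (local_const R d (fun=> false)).
have Lc e' : at_level e' col by apply: at_levelW col_level.
have Lr : at_level e.+1 (fun G => residual (ball G r) (col G) c (g G)).
  apply: (at_level_ball 0 (leqnn r) (Lc e) Lg Lg) => G G' v bE fE.
  have [cv gv _] := fE v (ball_refl _ _ _).
  rewrite /residual cv gv -bE; congr (if _ then _ else Num.max _ (_ - _)).
  apply: eq_big => [u|u /andP[/fE[]//]].
  by have [/fE[-> _ _]|//] := boolP (u \in _).
rewrite mulnS addnCA addSn addSn add0n -addSn.
have Lg' : at_level (e.+1 + 2 * size cs) g by apply: at_levelW Lg; lia.
apply: (at_level_ball false (leqnn r) (Lc _) Lg' (IH _ _ Lr)) => G G' v bE fE.
have [cv gv Iv] := fE v (ball_refl _ _ _).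
rewrite /extend cv gv Iv -bE; congr (_ || [&& _, _ & _]).
apply: eq_forallb => u.
by have [/fE[_ _ ->]|//] := boolP (u \in _).
Qed.

Lemma best_gain_level e (m : graph -> V -> V) : at_level e m ->
  at_level e.+1 (fun G v => (best G L (m G) v, gain G L (m G) v)).
Proof.
move=> Lm; have Lr : at_level e edge_row by apply: at_levelW edge_row_level.
have y0 : {ffun V -> V} := finfun id.
apply: (at_level_ball (y0, 0) (leq_addr L L) Lm Lr Lr) => G G' v bE fE.
have mE x : x \in ball G L v -> m G x = m G' x by case/fE.
have aE x : x \in ball G L v -> adj G x = adj G' x.
  by case/fE => _ [aE _] _; apply/funext => y; rewrite aE.
have wE x : x \in ball G L v -> edge_wt G x = edge_wt G' x by case/fE => _ [_ ->].
have sumE (f : V -> V) : \sum_(x in ball G L v) edge_wt G x (f x) =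
                         \sum_(x in ball G' L v) edge_wt G' x (f x).
  by rewrite -bE; apply: eq_bigr => x /wE->.
have bestE : best G L (m G) v = best G' L (m G') v.
  have candE : cand G L (m G) v = cand G' L (m G') v.
    apply/funext => f; apply: eq_forallb => x; rewrite -bE /near.
    by case: ifP => // xv; rewrite mE // aE.
  have cropE : crop G L (m G) v = crop G' L (m G') v.
    by apply/ffunP => x; rewrite !ffunE -bE; case: ifP => // /mE.
  rewrite /best candE cropE; congr (Order.arg_max _ _ _).
  by apply/funext => f.
rewrite bestE; congr (_, _ - _); rewrite ?bestE ?sumE //.
by rewrite -bE; apply: eq_bigr => x /mE->.
Qed.

(** One level for best replacements and gains, two per color for the selection, one for the
    update. *)
Lemma round_level e (m : graph -> V -> V) : at_level e m ->
  at_level (e + 2 * (#|C| + 1)) (fun G => round G L (col G) (m G)).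
Proof.
move=> Lm; have Lbg := best_gain_level Lm.
have Lb := local_map (fun _ => fst) Lbg; have Lg := local_map (fun _ => snd) Lbg.
have LI := select_level (enum C) Lg.
have -> : (e + 2 * (#|C| + 1) = (e.+1 + 2 * size (enum C)).+1)%N.
  by rewrite -cardE addSn mulnDr muln1 addnA addn2.
have [y0 _|n0] := pickP (@predT V); last first.
  exists (fun v => Output R n v) => G v; by have := n0 v.
have Lb' := at_levelW (leq_addr (2 * size (enum C)) e.+1) Lb.
have Lm' : at_level (e.+1 + 2 * size (enum C)) m.
  by apply: at_levelW Lm; rewrite addSn ltnW // ltnS leq_addr.
apply: (at_level_ball y0 (leq_addr L L) Lb' Lm' LI).
move=> G G' x bE fE; rewrite /round /update.
have [_ mx _] := fE x (ball_refl _ _ _).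
rewrite -bE (eq_pick (Q := fun v => (v \in ball G L x) &&
  select (ball G' r) (col G') (enum C) (gain G' L (m G')) v)).
  by case: pickP => // v /andP[/fE[/= -> _ _]].
by move=> v /=; have [/fE[_ _ ->]|//] := boolP (v \in _).
Qed.

Lemma iter_round_level T :
  at_level (T * (2 * (#|C| + 1))) (fun G => iter T (round G L (col G)) id).
Proof.
elim: T => [|T IH]; last by rewrite mulSn addnC; apply: round_level.
by apply: local_le (local_const R d id).
Qed.

End Levels.
End LocalAlgorithm.

(** * Counting probes *)

Section ProbeCount.
Local Open Scope nat_scope.

Definition label_count d k := d.+1 ^ (4 * k + 4 * k).

(** The square of [label_count] bounds the number of points spoiled in Linial's step, and 17 leaves
    room for the 16 symbols; a power of 2 is the order of a field. *)
Definition field_size d k :=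
  2 ^ up_log 2 (label_count d k * label_count d k + 17).

Definition base_cost d k K :=
  let r := 4 * k + 4 * k in let N := label_count d k in
  N * (r + N * (K.+1 * r)) + d.

(** The exponent is the number of rounds, [2 * k * N], times the levels per round, the colors being
    pairs of field elements. *)
Definition probe_count d k K :=
  let N := label_count d k in
  (4 * N) ^ (2 * k * N * (2 * (field_size d k ^ 2 + 1))) * base_cost d k K.

(** [K] enters through [base_cost] only, and linearly. The remaining factor is at most
    [2 ^ (N ^ 12)], and [N <= d ^ (16 * k)] because [d.+1 <= d ^ 2] for [d > 1]; 12 times 16 gives
    192. *)
Lemma probe_count_le d k K : 1 < d -> 0 < k -> 0 < K ->
  probe_count d k K <= 2 ^ (d ^ (192 * k)) * K.
Proof.
move=> d1 k0 K0; rewrite /probe_count /base_cost /field_size.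
set r := 4 * k + 4 * k; set N := label_count d k; set q := 2 ^ _.
have rE : r = 8 * k by rewrite /r -mulnDl.
have rN : r < N.
  rewrite /N /label_count -/r (leq_trans (ltn_expl r (isT : 1 < 2))) //.
  by rewrite leq_exp2r ?rE ?muln_gt0 // ltnW.
have dN : d < N.
  rewrite /N /label_count -/r -[d.+1]expn1 leq_pexp2l // rE muln_gt0 //.
have N64 : 64 <= N.
  apply: (@leq_trans (3 ^ 8)) => //; rewrite /N /label_count -/r.
  apply: (@leq_trans (3 ^ r)); first by rewrite leq_pexp2l // rE leq_pmulr.
  by rewrite leq_exp2r ?rE ?muln_gt0.
have NX a b : a <= b -> N ^ a <= N ^ b by move=> ab; rewrite leq_pexp2l //; lia.
have qN : q <= N ^ 3.
  have := @up_log_gtn 2 (N * N + 17) isT; rewrite /q.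
  have : 0 < up_log 2 (N * N + 17) by rewrite up_log_gt0 /=; lia.
  case: (up_log _ _) => // u _ /= H; rewrite expnS.
  have {}H := H ltac:(lia); rewrite !expnS expn0 muln1.
  have : N * N * 64 <= N * N * N by rewrite leq_mul2l N64 orbT.
  have : 64 * 64 <= N * N by apply: leq_mul.
  lia.
have q2 : 2 * (q ^ 2 + 1) <= N ^ 7.
  have : q ^ 2 <= N ^ 6 by rewrite -[6]/(3 * 2) expnM leq_exp2r.
  have : 0 < N ^ 6 by rewrite expn_gt0; lia.
  have : N ^ 6 * 64 <= N ^ 6 * N by rewrite leq_mul2l N64 orbT.
  rewrite -expnSr; lia.
have E10 : 2 * k * N * (2 * (q ^ 2 + 1)) <= N ^ 10.
  rewrite -[10]/(3 + 7) expnD leq_mul // !expnS expn0 muln1 mulnA leq_mul //.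
  by apply: (@leq_trans N); [lia | rewrite leq_pmull //; lia].
have b2 : 4 * N <= N ^ 2 by rewrite -mulnn leq_mul2r; lia.
have base : N * (r + N * (K.+1 * r)) + d <= N ^ 4 * K.
  have h1 : K.+1 * r <= 2 * K * N by apply: leq_mul; lia.
  have h2 : N * (K.+1 * r) <= N * (2 * K * N) by rewrite leq_mul2l h1 orbT.
  have h3 : 64 * (N * N) <= N * (N * N) by rewrite leq_mul2r N64 orbT.
  have h4 : N <= N * N by rewrite leq_pmull //; lia.
  have h5 : N * 1 <= N * N * K by apply: leq_mul.
  have h6 : r + N * (K.+1 * r) <= 3 * (N * N * K) by lia.
  have h7 : N * (r + N * (K.+1 * r)) <= N * (3 * (N * N * K)).
    by rewrite leq_mul2l h6 orbT.
  have h8 : N * (N * N) * 64 * K <= N * (N * N) * N * K.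
    by rewrite leq_mul2r leq_mul2l N64 !orbT.
  have h9 : N * N * K <= N * (N * N) * K by rewrite leq_mul2r leq_pmull ?orbT //; lia.
  by rewrite !expnS expn0 muln1; lia.
apply: (@leq_trans ((N ^ 2) ^ (N ^ 10) * (N ^ 4 * K))).
  apply: leq_mul base.
  apply: (@leq_trans ((4 * N) ^ (N ^ 10))); first by rewrite leq_pexp2l //; lia.
  by rewrite leq_exp2r // expn_gt0; lia.
rewrite mulnA -expnM -expnD leq_mul2r; apply/orP; right.
have N10 : 64 <= N ^ 10 by apply: leq_trans N64 _; rewrite -{1}[N]expn1 NX.
have exp11 : 2 * N ^ 10 + 4 <= N ^ 11.
  have : 64 * N ^ 10 <= N * N ^ 10 by rewrite leq_mul2r N64 orbT.
  rewrite -expnS; lia.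
apply: leq_trans (NX _ _ exp11) _.
apply: (@leq_trans ((2 ^ N) ^ (N ^ 11))).
  by rewrite leq_exp2r ?expn_gt0; [rewrite ltnW // ltn_expl | lia].
rewrite -expnM -expnS leq_exp2l //.
apply: (@leq_trans ((d ^ (16 * k)) ^ 12)); last by rewrite -expnM mulnAC.
rewrite leq_exp2r // /N /label_count -/r rE -[16]/(2 * 8) -mulnA (expnM d 2).
rewrite leq_exp2r ?muln_gt0 // expnS expn1.
by apply: (@leq_trans (2 * d)); [lia | rewrite leq_mul2r d1 orbT].
Qed.

End ProbeCount.

(** * From local maps to online algorithms *)

Section Algorithm.
Variables (R : realType) (n : nat).

Definition stateless (P : {set 'I_n} -> probe_tree R n bool) : algorithm R n :=
  Algorithm tt (fun _ e => bind (P e) (fun a => Output R n (a, tt))).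

Lemma stateless_online P (G : wgraph R n) (M : {set {set 'I_n}}) (c : nat) (phi : R) qs :
  (forall e, e \in edges G ->
     (run G (P e)).1 = (e \in M) /\ ((run G (P e)).2 <= c)%N) ->
  c%:R <= phi -> all (fun e => e \in edges G) qs ->
  [seq a.1 | a <- online G (init (stateless P)) qs] = [seq e \in M | e <- qs] /\
  all (fun a => a.2%:R <= phi) (online G (init (stateless P)) qs).
Proof.
move=> HP cphi; rewrite /=; elim: qs => [//|e qs IH] /= /andP[eG /IH[IH1 IH2]].
have [H1 H2] := HP e eG; rewrite run_bind /= addn0 IH1 H1 IH2 andbT; split=> //.
by apply: le_trans cphi; rewrite ler_nat.
Qed.

Lemma edges_matching (G : wgraph R n) : (maxdeg G <= 1)%N -> matching G (edges G).
Proof.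
move=> G1; rewrite /matching subxx; apply/trivIsetP => e f eG fG.
apply: contraR => /pred0Pn[u /andP[/= ue uf]].
have other e' : e' \in edges G -> u \in e' -> exists2 v, adj G u v & e' = [set u; v].
  case/imset2P => x y _; rewrite inE => /andP[_ xy] ->; rewrite !inE.
  by case/orP => /eqP->; [exists y | exists x; rewrite 1?adj_sym 1?setUC].
have [v uv ->] := other e eG ue; have [w uw ->] := other f fG uf.
suff -> : v = w by [].
have : (#|adj G u| <= 1)%N.
  by apply: leq_trans G1; apply: (@leq_bigmax _ (fun v : 'I_n => #|adj G v|)).
by move/card_le1_eqP; apply.
Qed.

(** Treated apart because powers of a degree at most 1 do not exceed 1, so the exponent [c1 / eps]
    gives no room for probes; all edges together are optimal and no probe is made. *)
Lemma mwm_maxdeg1 (G : wgraph R n) (eps phi : R) : (maxdeg G <= 1)%N ->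
  positive_weights G -> 0 < eps -> 0 <= phi ->
  centlocal_mwm phi eps (stateless (fun=> Output R n true)) G.
Proof.
move=> G1 Gpos eps0 phi0; exists (edges G) => [|qs qG]; last first.
  by apply: (stateless_online (c := 0)) => // e eG; rewrite eG.
split=> [|M [/andP[MG _] _]]; first exact: edges_matching.
have wM : weight G M <= weight G (edges G).
  rewrite /weight [leRHS](big_setID M) /= (setIidPr MG) lerDl.
  by apply: sumr_ge0 => e; rewrite inE => /andP[_ /Gpos/ltW].
apply: le_trans wM; rewrite ler_piMl //; last by lra.
by apply: sumr_ge0 => e /(subsetP MG)/Gpos/ltW.
Qed.

Lemma mwm_exists d eps (k := (Num.truncn (eps^-1 : R)).+1) : 0 < eps ->
  exists P, forall (G : wgraph R n) (phi : R),
    maxdeg G = d -> positive_weights G ->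
    (probe_count d k (log_star R n))%:R <= phi ->
    centlocal_mwm phi eps (stateless P) G.
Proof.
move=> eps0; have k0 : (0 < k)%N by [].
have keps : 1 <= k%:R * eps.
  by rewrite -ler_pdivrMr // mul1r ltW // truncnS_gt.
set L := (4 * k)%N; set N := label_count d k.
have N0 : (0 < N)%N by rewrite expn_gt0.
have u0 : (0 < up_log 2 (N * N + 17))%N by rewrite up_log_gt0 /=; lia.
have [F _ cardF] := PrimePowerField (isT : prime 2) u0.
have leF : (N * N + 17 <= #|F|)%N by rewrite cardF up_logP.
have F16 : (16 <= #|F|)%N by apply: leq_trans leF; lia.
pose e (i : 'I_16) : F := enum_val (widen_ord F16 i).
have e_inj : injective e by move=> i j /enum_val_inj/(congr1 val)/= ij; apply: val_inj.
have cardF' : (d.+1 ^ (L + L) * d.+1 ^ (L + L) < #|F|)%N.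
  by apply: leq_trans leF; rewrite -[(d.+1 ^ (L + L))%N]/N; lia.
pose col (G : wgraph R n) := @color R n d (L + L) F e G.
pose Q := base_cost d k (log_star R n).
have LQ : (L + L <= Q)%N.
  rewrite /Q /base_cost -/N -/L (leq_trans _ (leq_addr _ _)) //.
  by rewrite (leq_trans _ (leq_pmull _ N0)) // leq_addr.
have colL : @at_level R n d L Q _ 0 col.
  apply: local_le (local_color R n d (L + L) e).
  by rewrite expn0 mul1n /Q /base_cost leq_addr.
have rowL : @at_level R n d L Q _ 0 (@edge_row R n).
  apply: local_le (local_edge_row R n d).
  by rewrite expn0 mul1n /Q /base_cost leq_addl.
have [P HP] := iter_round_level LQ colL rowL (2 * k * N).
exists (fun f : {set 'I_n} => if [pick u in f] is Some u then
  bind (P u) (fun v => Output R n (f == [set u; v])) else Output R n false).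
move=> G phi Gd Gpos cphi; have Gd' : (maxdeg G <= d)%N by rewrite Gd.
have col_proper u v : u \in ball G (L + L) v -> col G u = col G v -> u = v.
  exact: color_proper.
have D_ball v : (#|ball G (L + L) v| <= N)%N by apply: card_ball.
pose m := iter (2 * k * N) (round G L (col G)) id.
have mm : mates G m by apply: iter_round_mates.
exists (edge_set m).
  by apply: mates_approx_mwm => // o om; apply: iter_round_approx.
move=> qs qG; apply: stateless_online qG; last exact: cphi.
move=> f fG /=; case: pickP => [u uf|f0]; last first.
  by have := card_edge fG; rewrite eq_card0.
have [H1 H2] := HP G u Gd'; rewrite run_bind /= addn0 H1.
split; first by rewrite (mem_edge_set mm fG uf).
apply: leq_trans H2 _.
by rewrite /probe_count /field_size card_prod cardF mulnn.
Qed.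

End Algorithm.

(** * Comparison of the probe count with the stated bound *)

Section Bound.
Variable R : realType.

Lemma log_star_gt0 n : (1 < n)%N -> (0 < log_star R n)%N.
Proof.
move=> n1; rewrite /log_star; case: ex_minnP => -[|K] //=.
by rewrite lern1 leqNgt n1.
Qed.

Lemma maxdeg_lt n (G : wgraph R n) : (1 < maxdeg G)%N -> (1 < n)%N.
Proof.
move=> G1; apply: leq_trans G1 _; apply/bigmax_leqP => v _.
by rewrite -[leqRHS]card_ord max_card.
Qed.

Lemma w_min_gt0 n (G : wgraph R n) eps : positive_weights G -> max_weight G = 1 ->
  0 < w_min G eps.
Proof.
move=> Gpos G1; rewrite /w_min G1; elim/big_ind: _ => // [x y x0 y0|e /andP[/Gpos//]].
by rewrite lt_min x0.
Qed.

(** Since [k <= 2 / eps], 192 becomes 384. The base 2 becomes [1 / w] through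
    [2 <= (1 / omega) ^ (2 ^ a)], and [2 ^ a <= d ^ a] adds [a] to the constant. The linear
    [log_star] factor fits because [(1 / eps) * (1 + ln (1 / eps)) >= 1]. *)
Lemma probe_count_bound (omega : R) : omega < 1 -> exists c1 : R,
  forall (w eps : R) d n, 0 < eps -> eps < 1 -> 0 < w -> w <= omega ->
    (1 < d)%N -> (1 < n)%N ->
    (probe_count d (Num.truncn eps^-1).+1 (log_star R n))%:R
      <= probe_bound c1 1 w eps d n.
Proof.
move=> o1; have [o0|o0] := leP omega 0.
  exists 0 => w eps d n _ _ w0 wo.
  by have := lt_le_trans w0 (le_trans wo o0); rewrite ltxx.
have lo : 0 < ln omega^-1 by rewrite ln_gt0 // invf_gt1.
pose a := (Num.truncn (ln 2 / ln omega^-1)).+1.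
have aP : ln 2 <= 2 ^+ a * ln omega^-1 :> R.
  rewrite -ler_pdivrMr // (le_trans (ltW (truncnS_gt _))) // -natrX ler_nat.
  by rewrite ltnW // ltn_expl.
exists (384 + a%:R) => w eps d n eps0 eps1 w0 wo d1 n1.
set k := (Num.truncn eps^-1).+1.
have e1 : 1 <= eps^-1 by rewrite invf_ge1 // ltW.
have kle : k%:R <= 2 * eps^-1.
  rewrite /k -[X in X%:R <= _]addn1 natrD [leRHS]mulr_natl mulr2n lerD //.
  by rewrite truncn_le (le_trans ler01).
have K0 := log_star_gt0 n1.
have := probe_count_le d1 (isT : (0 < k)%N) K0; rewrite -(ler_nat R) => /le_trans; apply.
rewrite natrM /probe_bound ler_pM //; last first.
  rewrite mul1r -[leLHS]powRr1 // ler_powR ?ler1n //.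
  by rewrite -[leLHS]mulr1 ler_pM // lerDl ln_ge0.
have wi : 1 < w^-1 by rewrite invf_gt1 // (le_lt_trans wo).
have d1R : 1 <= d%:R :> R by rewrite ler1n ltnW.
rewrite -ler_ln ?posrE ?powR_gt0 ?ltr0n ?expn_gt0 ?invr_gt0 //.
rewrite ln_powR natrX lnXn // -[leLHS]mulr_natl natrX.
apply: (@le_trans _ _ (d%:R ^+ (192 * k) * (d%:R ^+ a * ln w^-1))).
  rewrite ler_wpM2l ?exprn_ge0 // (le_trans aP) // ler_pM ?exprn_ge0 ?(ltW lo) //.
    by rewrite lerXn2r ?nnegrE // ler_nat.
  by rewrite ler_ln ?posrE ?invr_gt0 // lef_pV2 ?posrE.
rewrite mulrA ler_wpM2r ?ln_ge0 ?(ltW wi) // -exprD -powR_mulrn // ler_powR //.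
rewrite natrD natrM [leRHS]mulrDl lerD //; last by rewrite ler_peMr.
by rewrite (natrM _ 192 2) -mulrA ler_pM2l.
Qed.

End Bound.

Theorem theorem26 (R : realType) :
  exists (A : forall n : nat, nat -> R -> algorithm R n) (c2 : R),
  forall omega : R, omega < 1 ->
  exists c1 : R,
  forall (eps : R) (n : nat) (G : wgraph R n),
    0 < eps -> eps < 1 ->
    positive_weights G -> max_weight G = 1 ->
    w_min G eps <= omega ->
    centlocal_mwm
      (probe_bound c1 c2 (w_min G eps) eps (maxdeg G) n) eps
      (A n (maxdeg G) eps) G.
Proof.
(* The algorithm is fixed before [omega] and [G], from [n], the degree and [eps] alone; the program
   comes from [mwm_exists] by choice, and the last branch is a filler for [eps <= 0]. *)
pose A n d (eps : R) : algorithm R n :=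
  if (d <= 1)%N then stateless (fun=> Output R n true)
  else if pselect (0 < eps) is left eps0 then
    stateless (projT1 (cid (mwm_exists n d eps0)))
  else stateless (fun=> Output R n true).
exists A, 1 => omega /probe_count_bound[c1 H]; exists c1.
move=> eps n G eps0 eps1 Gpos G1 wo; rewrite /A.
have [d1|d1] := leqP (maxdeg G) 1.
  by apply: mwm_maxdeg1 => //; rewrite mulr_ge0 ?powR_ge0.
case: pselect => // eps0'; case: (cid _) => P HP /=; apply: HP => //.
by apply: H => //; [apply: w_min_gt0 | apply: maxdeg_lt d1].
Qed.
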